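(* Consider the quadrotor rotational subsystem (after the inner feedback loop) with state $\mathbf{x}=(x_1,\dots,x_6)^T=(\phi,\dot\phi,\theta,\dot\theta,\psi,\dot\psi)^T$ and desired reference signal $(0,0,0)^T$: $$\begin{aligned} \dot x_1&=x_2,\\ \dot x_2&=a_1x_4x_6-a_2x_4\,g(\mathbf{u})-b_1k_p^\phi x_1+b_1v_1,\\ \dot x_3&=x_4,\\ \dot x_4&=a_3x_2x_6+a_4x_2\,g(\mathbf{u})-b_2k_p^\theta x_3+b_2v_2,\\ \dot x_5&=x_6,\\ \dot x_6&=a_5x_2x_4-b_3k_p^\psi x_5+b_3v_3, \end{aligned}$$ with input $\bm{v}=(v_1,v_2,v_3)^T$ and output $\bm{\eta}=(x_1,x_3,x_5)^T$, where $k_p^\phi,k_p^\theta,k_p^\psi>0$. Consider also the strictly negative imaginary linear controller with transfer function matrix $$\mathbf{C}_v(s)=[s\mathbf{I}+\bm{\Gamma}\bm{\Phi}]^{-1}\bm{\Gamma},$$ where $\bm{\Gamma}$ and $\bm{\Phi}$ are positive-definite $3\times3$ matrices and $\bm{\Phi}=\operatorname{diag}(\varphi,\varphi,\varphi)$, with tuning parameter $\varphi$ satisfying $$\varphi^2>\max\left\{\frac{1}{(k_p^\phi)^2},\frac{1}{(k_p^\theta)^2},\frac{1}{(k_p^\psi)^2}\right\}.$$ Assume that the rotational subsystem is zero-state observable. Then the closed-loop system formed by the positive feedback interconnection of the rotational subsystem and the controller (controller input $\bm{\eta}$, controller output $\bm{v}$) is asymptotically stable.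
   Context: The angles $\phi,\theta,\psi$ are the roll, pitch and yaw angles of the quadrotor; $\varphi$ denotes the scalar controller tuning parameter. Constants: $a_1=(J_y-J_z)/J_x$, $a_2=J_r/J_x$, $a_3=(J_z-J_x)/J_y$, $a_4=J_r/J_y$, $a_5=(J_x-J_y)/J_z$, $b_1=l/J_x$, $b_2=l/J_y$, $b_3=1/J_z$, where $J_x,J_y,J_z$ are the roll, pitch and yaw inertias (the rotational inertia matrix $\operatorname{diag}(J_x,J_y,J_z)$ is positive definite), $l$ is the arm length (distance from the axis of rotation of the rotors to the center of the quadrotor) and $J_r$ is a constant (the rotor inertia). The vector $\mathbf{u}=(u_1,u_2,u_3,u_4)^T$ is the quadrotor input: $u_1$ is the thrust, and $(u_2,u_3,u_4)^T$ is the torque input, given by the inner feedback law $(u_2,u_3,u_4)^T=-\operatorname{diag}(k_p^\phi,k_p^\theta,k_p^\psi)\bm{\eta}+\bm{v}$. The term $g(\mathbf{u})$ is a scalar function of the input appearing in the gyroscopic terms of the model; nothing further is specified about it. Strictly negative imaginary: a square transfer function matrix $G(s)$ is strictly negative imaginary if it has no poles in $\Re[s]\ge0$ and $j[G(j\omega)-G^T(j\omega)]>0$ for $\omega\in(0,\infty)$. Zero-state observable (standard meaning): with zero input, the only solution whose output is identically zero is the zero solution. Asymptotic stability of the closed-loop system refers to its equilibrium in which the subsystem state and the controller state are both zero.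
   Formalization: Adds that g is bounded on bounded sets and that the thrust u_1 is a bounded function of time (unbounded thrust with g(u)=u_1 can destroy attractivity); in the strictly negative imaginary condition the transpose is read as the conjugate transpose. *)

(* Defs.v *)
(* MathComp / MathComp-Analysis *)
From HB Require Import structures.
From mathcomp Require Import all_boot all_order all_algebra.
From mathcomp Require Import complex.
From mathcomp Require Import all_classical all_reals all_analysis.
Set Implicit Arguments.
Unset Strict Implicit.
Unset Printing Implicit Defensive.
Import Order.TTheory GRing.Theory Num.Theory.
Import numFieldNormedType.Exports.
Local Open Scope classical_set_scope.
Local Open Scope ring_scope.

Definition posdefmx (R : realType) (n : nat) (A : 'M[R]_n) : Prop :=
  A^T = A /\
  forall x : 'cV[R]_n, x != 0 -> 0 < (x^T *m A *m x) ord0 ord0.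

Definition conjtrmx (K : numClosedFieldType) (m n : nat) (A : 'M[K]_(m, n)) :
  'M[K]_(n, m) := map_mx Num.conj (A^T).

Definition hposdefmx (K : numClosedFieldType) (n : nat) (A : 'M[K]_n) : Prop :=
  conjtrmx A = A /\
  forall x : 'cV[K]_n, x != 0 -> 0 < (conjtrmx x *m A *m x) ord0 ord0.

(* Transfer function matrices are matrices of rational functions with real
   coefficients, the indeterminate 'X being the Laplace variable s. *)

Definition ratfun (R : realType) := {fraction {poly R}}.

Definition cst_tf (R : realType) (m n : nat) (A : 'M[R]_(m, n)) :
    'M[ratfun R]_(m, n) :=
  map_mx (fun a : R => FracField.tofrac (a%:P)) A.

Definition s_tf (R : realType) : ratfun R := FracField.tofrac ('X : {poly R}).

Definition complex_horner (R : realType) (p : {poly R}) (s : R[i]) : R[i] :=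
  (map_poly (real_complex R) p).[s].

(* f is regular (has no pole) at s and takes there the value w. *)
Definition ratfun_value (R : realType) (f : ratfun R) (s w : R[i]) : Prop :=
  exists p q : {poly R},
    [/\ f = FracField.tofrac p / FracField.tofrac q,
        complex_horner q s != 0
      & w = complex_horner p s / complex_horner q s].

Definition tf_value (R : realType) (m n : nat) (G : 'M[ratfun R]_(m, n))
    (s : R[i]) (W : 'M[R[i]]_(m, n)) : Prop :=
  forall i j, ratfun_value (G i j) s (W i j).

Definition is_pole (R : realType) (m n : nat) (G : 'M[ratfun R]_(m, n))
    (s : R[i]) : Prop :=
  exists i j, ~ exists w, ratfun_value (G i j) s w.

(* The transpose in j[G(jw) - G^T(jw)] > 0 is the conjugate transpose, i.e.
   the adjoint system G^T(-s) evaluated at s = jw; with a plain transpose the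
   matrix would not be Hermitian, and it would vanish for symmetric G. *)
Definition strictly_negative_imaginary (R : realType) (n : nat)
    (G : 'M[ratfun R]_n) : Prop :=
  (forall s : R[i], 0 <= complex.Re s -> ~ is_pole G s) /\
  (forall (w : R) (W : 'M[R[i]]_n), 0 < w ->
     tf_value G ('i * real_complex R w) W -> hposdefmx ('i *: (W - conjtrmx W))).

Definition is_realization (R : realType) (n m p : nat) (G : 'M[ratfun R]_(p, m))
    (A : 'M[R]_n) (B : 'M[R]_(n, m)) (C : 'M[R]_(p, n)) : Prop :=
  G = cst_tf C *m invmx ((s_tf R)%:M - cst_tf A) *m cst_tf B.

(* No feedthrough term: only used for strictly proper transfer functions. *)
Definition is_minimal_realization (R : realType) (n m p : nat)
    (G : 'M[ratfun R]_(p, m))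
    (A : 'M[R]_n) (B : 'M[R]_(n, m)) (C : 'M[R]_(p, n)) : Prop :=
  is_realization G A B C /\
  forall (n' : nat) (A' : 'M[R]_n') (B' : 'M[R]_(n', m)) (C' : 'M[R]_(p, n')),
    is_realization G A' B' C' -> (n <= n')%N.

Definition Cv (R : realType) (Gamma Phi : 'M[R]_3) : 'M[ratfun R]_3 :=
  invmx ((s_tf R)%:M + cst_tf (Gamma *m Phi)) *m cst_tf Gamma.

(* x solves x' = f(t, x) on [t0, T[ (T may be +oo). *)
Definition is_solution (R : realType) (V : normedModType R) (f : R -> V -> V)
    (t0 : R) (T : \bar R) (x : R -> V) : Prop :=
  {within [set t | t0 <= t /\ (t%:E < T)%E], continuous x} /\
  forall t : R, t0 < t -> (t%:E < T)%E -> is_derive t (1 : R) x (f t (x t)).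

(* Asymptotic stability of the equilibrium 0 of x' = f(t, x), t >= 0.
   Solutions are not assumed to be global in the stability clause. *)
Definition lyapunov_stable (R : realType) (V : normedModType R)
    (f : R -> V -> V) : Prop :=
  forall t0 eps : R, 0 <= t0 -> 0 < eps ->
  exists2 delta : R, 0 < delta &
    forall (T : \bar R) (x : R -> V),
      is_solution f t0 T x -> `|x t0| < delta ->
      forall t : R, t0 <= t -> (t%:E < T)%E -> `|x t| < eps.

Definition attractive (R : realType) (V : normedModType R)
    (f : R -> V -> V) : Prop :=
  forall t0 : R, 0 <= t0 ->
  exists2 delta : R, 0 < delta &
    forall x : R -> V,
      is_solution f t0 +oo%E x -> `|x t0| < delta ->
      x t @[t --> +oo] --> (0 : V).

Definition asymptotically_stable (R : realType) (V : normedModType R)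
    (f : R -> V -> V) : Prop :=
  [/\ forall t : R, 0 <= t -> f t 0 = 0,
      lyapunov_stable f
    & attractive f].

Definition zero_state_observable (R : realType) (V U Y : normedModType R)
    (f : R -> V -> U -> V) (h : V -> Y) : Prop :=
  forall (t0 : R) (x : R -> V), 0 <= t0 ->
    is_solution (fun t y => f t y 0) t0 +oo%E x ->
    (forall t : R, t0 <= t -> h (x t) = 0) ->
    forall t : R, t0 <= t -> x t = 0.

Record quadrotor (R : realType) := Quadrotor {
  Jx : R; Jy : R; Jz : R; (* roll, pitch and yaw inertias *)
  Jr : R;                 (* rotor inertia *)
  arm : R                 (* arm length l *)
}.

Section Rotational.
Variables (R : realType) (p : quadrotor R).

Definition a1 := (Jy p - Jz p) / Jx p.
Definition a2 := Jr p / Jx p.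
Definition a3 := (Jz p - Jx p) / Jy p.
Definition a4 := Jr p / Jy p.
Definition a5 := (Jx p - Jy p) / Jz p.
Definition b1 := arm p / Jx p.
Definition b2 := arm p / Jy p.
Definition b3 := 1 / Jz p.

(* 1-based coordinate of a column vector *)
Definition coord1 (n : nat) (x : 'cV[R]_n.+1) (k : nat) : R :=
  x (inord k.-1) ord0.

Definition vec3 (c1 c2 c3 : R) : 'cV[R]_3 := \col_i [:: c1; c2; c3]`_i.

Definition vec6 (c1 c2 c3 c4 c5 c6 : R) : 'cV[R]_6 :=
  \col_i [:: c1; c2; c3; c4; c5; c6]`_i.

Definition attitude (x : 'cV[R]_6) : 'cV[R]_3 :=
  vec3 (coord1 x 1) (coord1 x 3) (coord1 x 5).

(* kp collects the proportional gains of the inner loop; the thrust u1 is not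
   affected by that loop. *)
Definition quad_input (kp : 'cV[R]_3) (u1 : R) (x : 'cV[R]_6) (v : 'cV[R]_3) :
    'cV[R]_4 :=
  col_mx (u1%:M : 'cV[R]_1) (- (diag_mx kp^T *m attitude x) + v).

Definition rotational (g : 'cV[R]_4 -> R) (kp : 'cV[R]_3) (u1 : R -> R)
    (t : R) (x : 'cV[R]_6) (v : 'cV[R]_3) : 'cV[R]_6 :=
  let x1 := coord1 x 1 in let x2 := coord1 x 2 in
  let x3 := coord1 x 3 in let x4 := coord1 x 4 in
  let x5 := coord1 x 5 in let x6 := coord1 x 6 in
  let gu := g (quad_input kp (u1 t) x v) in
  vec6
    x2
    (a1 * x4 * x6 - a2 * x4 * gu - b1 * coord1 kp 1 * x1 + b1 * coord1 v 1)
    x4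
    (a3 * x2 * x6 + a4 * x2 * gu - b2 * coord1 kp 2 * x3 + b2 * coord1 v 2)
    x6
    (a5 * x2 * x4 - b3 * coord1 kp 3 * x5 + b3 * coord1 v 3).

End Rotational.

(* Positive feedback interconnection of x' = f(t, x, v), y = h(x) with the
   linear system z' = A z + B y, v = C z. *)
Definition positive_feedback (R : realType) (V : normedModType R) (n m : nat)
    (f : R -> V -> 'cV[R]_m -> V) (h : V -> 'cV[R]_m)
    (A : 'M[R]_n) (B : 'M[R]_(n, m)) (C : 'M[R]_(m, n))
    (t : R) (xz : V * 'cV[R]_n) : V * 'cV[R]_n :=
  (f t xz.1 (C *m xz.2), A *m xz.2 + B *m h xz.1).

(* Main.v *)
(* Since Cv^-1 = Gamma^-1 s + Phi, comparing coefficients of s shows that a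
   minimal realization is similar to v' = - Gamma e with e = phi v - eta. With
   d = (b1, b2, b3), kappa = k - 1 / phi > 0 and rates p = eta', the loop reads
     eta' = p,  p' = d (e / phi - kappa eta) + F,  e' = - phi Gamma e - p,
   where F collects the gyroscopic terms, linear in p with coefficients bounded near 0.
   The energy sum p^2 / (2 d) + kappa eta^2 / 2 + e^2 / (2 phi) decays at rate
   e^T Gamma e, up to a cubic term (Jx - Jy) (1 - 1 / l) p1 p2 p3. The thrust
   makes the loop time-varying, so LaSalle's principle is not available; adding
   the cross terms eps (e p + h eta p) gives a quadratic function whose
   derivative is negative definite near 0, hence local exponential decay. *)
Require Import Defs.
From HB Require Import structures.
From mathcomp Require Import all_boot all_order all_algebra.
From mathcomp Require Import complex.
From mathcomp Require Import all_classical all_reals all_analysis.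
From mathcomp Require Import ring lra.
Import Order.TTheory GRing.Theory Num.Theory.
Import numFieldNormedType.Exports.
Local Open Scope classical_set_scope.
Local Open Scope ring_scope.

Set Implicit Arguments.
Unset Strict Implicit.
Unset Printing Implicit Defensive.

(** * Lyapunov's direct method for time-varying systems, with a function [W] comparable to the
    squared norm *)

Section LyapunovDirectMethod.
Variables (R : realType) (V : normedModType R) (f : R -> V -> V) (W : V -> R).
Variables (m M c r : R).
Hypotheses (m_gt0 : 0 < m) (M_gt0 : 0 < M) (c_gt0 : 0 < c) (r_gt0 : 0 < r).
Hypothesis W_continuous : continuous W.
Hypothesis W_ge : forall X, m * `|X| ^+ 2 <= W X.
Hypothesis W_le : forall X, W X <= M * `|X| ^+ 2.
(** Decay is required along curves that satisfy the equation at the single time [t], so no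
    differential of [W] on [V] is involved. *)
Hypothesis W_decay : forall (x : R -> V) (t : R), 0 <= t ->
  is_derive t (1 : R) x (f t (x t)) -> `|x t| < r ->
  exists2 d, is_derive t (1 : R) (W \o x) d & d <= - c * W (x t).

Lemma solution_continuous (t0 t1 : R) (T : \bar R) (x : R -> V) :
  is_solution f t0 T x -> (t1%:E < T)%E -> {within `[t0, t1], continuous x}.
Proof.
move=> [cx _] t1T; apply: continuous_subspaceW cx => t /=.
rewrite in_itv /= => /andP[t0t tt1]; split=> //.
by apply: le_lt_trans t1T; rewrite lee_fin.
Qed.

(** Multiplied by [expR (c * (t - t0))], the function [W] along the solution has nonpositive
    derivative, and the mean value theorem concludes. *)
Lemma lyapunov_exp_decay (t0 t1 : R) (T : \bar R) (x : R -> V) :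
  0 <= t0 -> is_solution f t0 T x -> t0 <= t1 -> (t1%:E < T)%E ->
  (forall t, t0 < t < t1 -> `|x t| < r) ->
  W (x t1) <= expR (- c * (t1 - t0)) * W (x t0).
Proof.
have [m0 M0 c0 r0] := And4 m_gt0 M_gt0 c_gt0 r_gt0.
move=> t0_ge0 solx t01 t1T xr; move: (t01).
rewrite le_eqVlt => /predU1P[<-|t0t1]; first by rewrite subrr mulr0 expR0 mul1r.
pose k t := expR (c * (t - t0)) * W (x t).
(* Membership sits under the existential so that [choice] gives a total function [dk], with dummy
   value 0 off the interval. *)
have der t : exists d, t \in `]t0, t1[ -> is_derive t 1 k d /\ d <= 0.
  case: (boolP (t \in `]t0, t1[)) => tin; last by exists 0.
  move: (tin); rewrite in_itv /= => /andP[t0t tt1].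
  have dx : is_derive t 1 x (f t (x t)).
    apply: solx.2 => //; apply: lt_trans t1T; by rewrite lte_fin.
  have [||d dW dle] := W_decay _ dx; [lra|by rewrite xr// t0t|].
  have dE : is_derive t 1 (fun t => expR (c * (t - t0))) (expR (c * (t - t0)) * c).
    have h : is_derive t 1 (fun t : R => c * (t - t0)) c.
      by apply: is_derive_eq; rewrite subr0; exact: mulr1.
    exact: (@is_derive1_comp _ expR (fun t => c * (t - t0))).
  exists (expR (c * (t - t0)) * d + W (x t) * (expR (c * (t - t0)) * c)) => _; split.
    exact: (@is_deriveM _ _ (fun t => expR (c * (t - t0))) (W \o x)).
  have e0 := expR_gt0 (c * (t - t0)).
  by rewrite (_ : _ + _ = expR (c * (t - t0)) * (d + c * W (x t))); [nra|ring].
have [dk dkP] := choice der.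
have [t /dkP[_ dle] kE] : exists2 t, t \in `]t0, t1[ & k t1 - k t0 = dk t * (t1 - t0).
  apply: MVT => // [t /dkP[]//|].
  have cx := solution_continuous solx t1T.
  have cW : {within `[t0, t1], continuous (W \o x)}.
    by apply: within_continuous_comp => // X _; exact: W_continuous.
  have cE : {within `[t0, t1], continuous (fun t => expR (c * (t - t0)))}.
    apply: continuous_subspaceT => t.
    apply: continuous_comp; last exact: continuous_expR.
    by apply: cvgM; [exact: cvg_cst|apply: cvgB; [exact: cvg_id|exact: cvg_cst]].
  by move=> t; exact: (cvgM (cE t) (cW t)).
have : k t1 <= k t0 by rewrite -subr_le0 kE; nra.
rewrite /k subrr mulr0 expR0 mul1r mulNr expRN => kle.
by rewrite mulrC ler_pdivlMr ?expR_gt0// mulrC.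
Qed.

(** First-exit argument: at the first time [s] with [eps <= |x s|], decay up to [s] would give [m *
    eps ^+ 2 <= W (x s) <= W (x t0) <= M * |x t0| ^+ 2 < m * eps ^+ 2]. *)
Lemma lyapunov_confined (t0 eps : R) (T : \bar R) (x : R -> V) :
  0 <= t0 -> is_solution f t0 T x -> 0 < eps <= r ->
  `|x t0| < eps -> M * `|x t0| ^+ 2 < m * eps ^+ 2 ->
  forall t, t0 <= t -> (t%:E < T)%E -> `|x t| < eps.
Proof.
have [m0 M0 c0 r0] := And4 m_gt0 M_gt0 c_gt0 r_gt0.
move=> t0_ge0 solx /andP[eps0 epsr] x0 x0M t1 t01 t1T.
rewrite ltNge; apply/negP => xt1.
have cN : {within `[t0, t1], continuous (fun t => `|x t|)}.
  apply: within_continuous_comp (solution_continuous solx t1T) => X _.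
  exact: norm_continuous.
(* The exit times up to [t1] form a nonempty compact set, whose least element is the first exit
   time. *)
pose E : set R := `[t0, t1]%classic `&` (fun t => `|x t|) @^-1` [set y | eps <= y].
have cE : compact E.
  apply: (@subclosed_compact _ _ `[t0, t1]); last by apply: subIsetl.
  - rewrite /E setIC closed_setIS; last exact: itv_closed.
    exact: ((continuous_closedP _).1 cN _ (@closed_ge _ eps)).
  - exact: segment_compact.
have [s [t0s st1 xs smin]] : exists s : R, [/\ t0 <= s, s <= t1, eps <= `|x s|
    & forall t, t0 <= t -> t <= t1 -> eps <= `|x t| -> s <= t].
  have [||s /set_mem[] + /= xs smin] := compact_EVT_min (f := fun t : R => t) _ cE.
  - by exists t1; split=> //=; rewrite in_itv /= t01 lexx.
  - by apply: continuous_subspaceT => t; exact: cvg_id.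
  rewrite /= in_itv /= => /andP[t0s st1]; exists s; split=> // t t0t tt1 xt.
  by apply: smin; apply/mem_set; split; rewrite //= in_itv /= t0t.
clear cN E cE; have sT : (s%:E < T)%E by apply: le_lt_trans t1T; rewrite lee_fin.
have : W (x s) <= expR (- c * (s - t0)) * W (x t0).
  apply: lyapunov_exp_decay t0s sT _ => // t /andP[t0t ts].
  rewrite ltNge; apply/negP => rxt.
  suff : s <= t by lra.
  apply: smin; lra.
have eS : expR (- c * (s - t0)) <= 1.
  by rewrite -expR0 ler_expR mulNr oppr_le0 mulr_ge0 ?subr_ge0// ltW.
have W0 : 0 <= W (x t0) by apply: le_trans (W_ge _); rewrite mulr_ge0 ?sqr_ge0//; lra.
have := W_le (x t0); have := W_ge (x s).
have : eps ^+ 2 <= `|x s| ^+ 2 by rewrite ler_pXn2r// nnegrE; lra.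
nra.
Qed.

(** The ratio [b = m / (m + M)] satisfies [b < 1] and [M * b < m], hence [M * b ^+ 2 < m]; this
    replaces the square root of [m / M]. *)
Lemma lyapunov_initial_radius (eps : R) : 0 < eps ->
  exists2 delta, 0 < delta & forall X : V, `|X| < delta ->
    `|X| < eps /\ M * `|X| ^+ 2 < m * eps ^+ 2.
Proof.
have [m0 M0 c0 r0] := And4 m_gt0 M_gt0 c_gt0 r_gt0.
move=> eps0; pose b := m / (m + M).
have b0 : 0 < b by rewrite divr_gt0// addr_gt0.
have b1 : b < 1 by rewrite ltr_pdivrMr ?addr_gt0// mul1r ltrDl.
have bM : M * b < m by rewrite mulrA ltr_pdivrMr ?addr_gt0//; nra.
exists (eps * b) => [|X Xd]; first exact: mulr_gt0.
have X0 := normr_ge0 X; have Xe : `|X| < eps by apply: lt_le_trans Xd _; nra.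
split=> //.
have : `|X| ^+ 2 <= (eps * b) ^+ 2 by rewrite ler_pXn2r// ?nnegrE; nra.
rewrite exprMn => XX.
have bb : b ^+ 2 <= b by rewrite expr2; nra.
have e2 : 0 < eps ^+ 2 by rewrite exprn_gt0.
have : eps ^+ 2 * b ^+ 2 <= eps ^+ 2 * b by nra.
by nra.
Qed.

Lemma lyapunov_stability : lyapunov_stable f.
Proof.
move=> t0 eps t0_ge0 eps0.
(* Confinement only works inside the ball of radius [r] where [W] is known to decay. *)
have e0 : 0 < Num.min eps r by rewrite lt_min eps0.
have [delta delta0 dP] := lyapunov_initial_radius e0.
exists delta => // T x solx /dP[x0 x0M] t t0t tT.
have : `|x t| < Num.min eps r.
  by apply: (lyapunov_confined t0_ge0 solx _ x0 x0M); rewrite // e0 ge_min lexx orbT.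
by rewrite lt_min => /andP[].
Qed.

Lemma lyapunov_attractivity : attractive f.
Proof.
have [m0 M0 c0 r0] := And4 m_gt0 M_gt0 c_gt0 r_gt0.
move=> t0 t0_ge0; have [delta delta0 dP] := lyapunov_initial_radius r_gt0.
exists delta => // x solx /dP[x0 x0M].
have xr t : t0 <= t -> `|x t| < r.
  move=> t0t; apply: (lyapunov_confined t0_ge0 solx _ x0 x0M); rewrite ?ltry//.
  by rewrite r_gt0 lexx.
have decay t : t0 <= t -> m * `|x t| ^+ 2 <= expR (- c * (t - t0)) * W (x t0).
  move=> t0t; apply: le_trans (W_ge _) _.
  apply: (lyapunov_exp_decay t0_ge0 solx); rewrite ?ltry// => s /andP[/ltW + _].
  exact: xr.
have W0 : 0 <= W (x t0) by apply: le_trans (W_ge _); rewrite mulr_ge0 ?sqr_ge0//; lra.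
apply/cvgr0Pnorm_lt => e e0.
have me : 0 < m * e ^+ 2 by rewrite mulr_gt0// exprn_gt0.
(* [expR (- y) <= 1 / (1 + y)] turns the exponential bound into an explicit time. *)
near=> t.
have t0t : t0 <= t by near: t; apply: nbhs_pinfty_ge; exact: num_real.
have tbig : t0 + W (x t0) / (c * (m * e ^+ 2)) < t.
  by near: t; apply: nbhs_pinfty_gt; exact: num_real.
have := decay t t0t; rewrite mulNr expRN => dt.
have y0 : 0 <= c * (t - t0) by rewrite mulr_ge0//; lra.
have E1 := expR_ge1Dx (c * (t - t0)).
have : m * `|x t| ^+ 2 * (1 + c * (t - t0)) <= W (x t0).
  have xx : 0 <= m * `|x t| ^+ 2 by rewrite mulr_ge0 ?sqr_ge0//; lra.
  move: dt; rewrite [leRHS]mulrC ler_pdivlMr ?expR_gt0// => dt.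
  by apply: le_trans dt; rewrite ler_wpM2l.
have : W (x t0) < m * e ^+ 2 * (c * (t - t0)).
  move: tbig; rewrite -ltrBrDl ltr_pdivrMr ?mulr_gt0//.
  by rewrite [X in _ < X -> _](_ : _ = m * e ^+ 2 * (c * (t - t0)))//; ring.
move=> h1 h2; rewrite ltNge; apply/negP => ex.
have : e ^+ 2 <= `|x t| ^+ 2 by rewrite ler_pXn2r// nnegrE; lra.
move=> h3; have : m * e ^+ 2 <= m * `|x t| ^+ 2 by rewrite ler_wpM2l//; lra.
nra.
Unshelve. all: by end_near. Qed.

End LyapunovDirectMethod.

(** * Minimal realizations of the controller transfer matrix *)

Section ControllerRealization.
Variable R : realType.

Lemma cst_tfM (m n p : nat) (A : 'M[R]_(m, n)) (B : 'M[R]_(n, p)) :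
  cst_tf (A *m B) = cst_tf A *m cst_tf B.
Proof. exact: (@map_mxM _ _ (@FracField.tofrac {poly R} \o polyC)). Qed.

Lemma cst_tf1 (n : nat) : cst_tf (1%:M : 'M[R]_n) = 1%:M.
Proof. exact: (@map_mx1 _ _ (@FracField.tofrac {poly R} \o polyC)). Qed.

Lemma cst_tfN (m n : nat) (A : 'M[R]_(m, n)) : cst_tf (- A) = - cst_tf A.
Proof. exact: (@map_mxN _ _ (@FracField.tofrac {poly R} \o polyC)). Qed.

Lemma cst_tf_unit (n : nat) (A : 'M[R]_n) :
  (cst_tf A \in unitmx) = (A \in unitmx).
Proof. exact: (@map_unitmx _ _ (@FracField.tofrac {poly R} \o polyC)). Qed.

(** The determinant is the characteristic polynomial of [A], which is monic and so nonzero in the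
    fraction field. *)
Lemma resolvent_unit (n : nat) (A : 'M[R]_n) : (s_tf R)%:M - cst_tf A \in unitmx.
Proof.
have -> : (s_tf R)%:M - cst_tf A = map_mx (@FracField.tofrac {poly R}) (char_poly_mx A).
  apply/matrixP => i j; rewrite !mxE [RHS]raddfB /=; congr (_ - _).
  by case: (i == j); rewrite ?mulr1n ?mulr0n ?raddf0.
rewrite unitmxE (@det_map_mx _ _ (@FracField.tofrac {poly R})) unitfE.
rewrite (@tofrac_eq0 {poly R}) -/(char_poly A).
exact: monic_neq0 (char_poly_monic A).
Qed.

(** Polynomials embed into fractions, so the coefficients of degree 1 and 0 in [s] can be
    compared. *)
Lemma pencil_inj (m n : nat) (P P' Q Q' : 'M[R]_(m, n)) :
  s_tf R *: cst_tf P + cst_tf Q = s_tf R *: cst_tf P' + cst_tf Q' ->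
  P = P' /\ Q = Q'.
Proof.
move=> /matrixP H.
have K i j : 'X * (P i j)%:P + (Q i j)%:P = 'X * (P' i j)%:P + (Q' i j)%:P.
  apply/eqP; rewrite -tofrac_eq; apply/eqP.
  by have := H i j; rewrite !mxE !rmorphD !rmorphM.
split; apply/matrixP => i j.
- have /(congr1 (fun p : {poly R} => p`_1)) := K i j.
  by rewrite !coefD !coefXM !coefC /= !addr0.
- have /(congr1 (fun p : {poly R} => p`_0)) := K i j.
  by rewrite !coefD !coefXM !coefC /= !add0r.
Qed.

(** Clears both resolvents: with [N] and [S] affine in [s], the equality of transfer matrices
    becomes one between pencils. *)
Lemma resolvent_intertwining (K : fieldType) (n : nat) (N S C B B' G : 'M[K]_n) :
  N \in unitmx -> S \in unitmx -> B *m B' = 1%:M ->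
  invmx N *m G = C *m invmx S *m B -> N *m C = G *m B' *m S.
Proof.
move=> uN uS BB /(congr1 (fun X => N *m (X *m B' *m S))).
by rewrite -!mulmxA [B *m _]mulmxA BB mul1mx mulVmx// mulmx1 mulKVmx// => ->.
Qed.

(** The quadratic form would vanish at a nonzero kernel vector. *)
Lemma posdefmx_unit (n : nat) (A : 'M[R]_n) : posdefmx A -> A \in unitmx.
Proof.
move=> [Asym Apos]; rewrite -unitmx_tr -row_free_unit -kermx_eq0.
apply/eqP/row_matrixP => i; rewrite row0; apply/eqP; apply: contraT => v0.
have vA : row i (kermx A^T) *m A = 0 by rewrite -{2}Asym -row_mul mulmx_ker row0.
have := Apos (row i (kermx A^T))^T.
by rewrite trmx_eq0 v0 trmxK vA mul0mx mxE ltxx => /(_ isT).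
Qed.

Variables Gamma Phi : 'M[R]_3.
Hypothesis Gamma_posdef : posdefmx Gamma.

Lemma Cv_unit : Cv Gamma Phi \in unitmx.
Proof.
rewrite /Cv unitmx_mul unitmx_inv cst_tf_unit posdefmx_unit// andbT.
by rewrite -[cst_tf _]opprK -cst_tfN resolvent_unit.
Qed.

(** The obvious realization has dimension 3 and [Cv] has rank 3, so [n = 3] and [B], [C] are
    invertible. These conclusions say that the output [v = C z] obeys
    [v' = - Gamma (Phi v - eta)]. *)
Lemma Cv_minimal_realization (n : nat) (A : 'M[R]_n) (B : 'M[R]_(n, 3))
    (C : 'M[R]_(3, n)) :
  is_minimal_realization (Cv Gamma Phi) A B C ->
  [/\ exists D : 'M[R]_(n, 3), D *m C = 1%:M,
      C *m B = Gamma & C *m A = - (Gamma *m Phi) *m C].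
Proof.
move=> [real minimal].
have n_le3 : (n <= 3)%N.
  apply: (minimal _ (- (Gamma *m Phi)) Gamma 1%:M).
  by rewrite /is_realization cst_tf1 mul1mx cst_tfN opprK.
(* The realization factors [Cv] through dimension [n], which bounds its rank. *)
have n_ge3 : (3 <= n)%N.
  rewrite -(mxrank_unit Cv_unit) real -mulmxA.
  by apply: leq_trans (mxrankM_maxl _ _) (rank_leq_col _).
have n3 : n = 3 by apply/eqP; rewrite eqn_leq n_le3.
subst n.
have := Cv_unit; rewrite {1}real !unitmx_mul => /andP[/andP[uC _] uB].
move: real; rewrite /is_realization.
set s := s_tf R => real.
have sA_unit : s%:M - cst_tf A \in unitmx by exact: resolvent_unit.
have sG_unit : s%:M + cst_tf (Gamma *m Phi) \in unitmx.
  by rewrite -[cst_tf _]opprK -cst_tfN resolvent_unit.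
rewrite cst_tf_unit in uC; rewrite cst_tf_unit in uB.
have BB : cst_tf B *m cst_tf (invmx B) = 1%:M by rewrite -cst_tfM mulmxV// cst_tf1.
(* This reads [(s + Gamma Phi) C = Gamma B^-1 (s - A)]: degree 1 gives [C = Gamma B^-1], degree 0
   gives [Gamma Phi C = - C A]. *)
have := resolvent_intertwining sG_unit sA_unit BB real.
rewrite -cst_tfM.
rewrite mulmxDl mulmxBr mul_scalar_mx mul_mx_scalar -!cst_tfM.
rewrite -cst_tfN => /pencil_inj[CE AE].
split; first by exists (invmx C); rewrite mulVmx.
- by rewrite CE mulmxKV.
- by rewrite mulNmx AE CE opprK.
Qed.

End ControllerRealization.

(** * A strict Lyapunov function for each axis, and the choice of its constants *)

Section StrictLyapunov.
Variable R : realType.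

Lemma young (t x y : R) : 0 < t -> x * y <= t * x ^+ 2 + y ^+ 2 / (4 * t).
Proof.
move=> t0; have -> : t * x ^+ 2 + y ^+ 2 / (4 * t) =
  x * y + t * (x - y / (2 * t)) ^+ 2 by field; lra.
by rewrite lerDl mulr_ge0 ?sqr_ge0// ltW.
Qed.

Definition axis_lyapunov (eps h phi d kappa q p e : R) : R :=
  p ^+ 2 / (2 * d) + kappa * q ^+ 2 / 2 + e ^+ 2 / (2 * phi)
  + eps * (e * p) + eps * h * (q * p).

(* Derivative of [axis_lyapunov] along q' = p, p' = d (e / phi - kappa q) + F,
   e' = - phi w - p; the quadratic terms not involving eps cancel except for
   the last two. *)
Definition axis_dissipation (eps h phi d kappa q p e w F : R) : R :=
  eps * ((- phi * w - p) * p + e * (d * (e / phi - kappa * q) + F))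
  + eps * h * (p ^+ 2 + q * (d * (e / phi - kappa * q) + F))
  + p * F / d - e * w.

(** Here [a] stands for [d * kappa] and [b] for [d / phi]. The product [e p] contributes [- p ^+ 2]
    and [h q p] contributes [- h a q ^+ 2]; Young's inequality absorbs all mixed products. *)
Lemma axis_cross_terms (h phi a b A B lo Fb q p e w F : R) :
  0 < h -> 0 < lo -> 0 < Fb -> lo <= a <= A -> 0 <= b <= B ->
  ((- phi * w - p) * p + e * (b * e - a * q + F))
  + h * (p ^+ 2 + q * (b * e - a * q + F))
  <= (h - 3 / 4) * p ^+ 2 + phi ^+ 2 * w ^+ 2
   + (1 / (4 * Fb) + h / lo) * F ^+ 2 - h * lo / 4 * q ^+ 2
   + (A / h + B + Fb + h * B ^+ 2 / lo) * e ^+ 2.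
Proof.
move=> h0 lo0 Fb0 /andP[la aA] /andP[b0 bB].
have a0 : 0 < a by lra.
(* The weights cost a quarter of [p ^+ 2], and a quarter of [h * a * q ^+ 2] for each of the three
   products with [q], leaving one quarter of the latter. *)
have y1 := @young (1 / 4) p (- phi * w) ltac:(lra).
have y2 := @young (h / 4) q (- e) ltac:(lra).
have y3 := @young Fb e F Fb0.
have y4 := @young (a / 4) q (b * e) ltac:(lra).
have y5 := @young (a / 4) q F ltac:(lra).
have e2 := sqr_ge0 e; have F2 := sqr_ge0 F; have q2 := sqr_ge0 q.
have z1 : (- phi * w) ^+ 2 / (4 * (1 / 4)) = phi ^+ 2 * w ^+ 2 by field.
have z2 : a * (q * (- e)) <= a * (h / 4 * q ^+ 2) + A / h * e ^+ 2.
  apply: le_trans (_ : a * (h / 4 * q ^+ 2 + (- e) ^+ 2 / (4 * (h / 4))) <= _).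
    by rewrite ler_wpM2l// ltW.
  rewrite mulrDr lerD2l (_ : a * _ = a / h * e ^+ 2); last by field; lra.
  by rewrite ler_wpM2r// ler_wpM2r// invr_ge0 ltW.
have z4 : (b * e) ^+ 2 / (4 * (a / 4)) <= B ^+ 2 / lo * e ^+ 2.
  rewrite (_ : (b * e) ^+ 2 / (4 * (a / 4)) = (b ^+ 2 / a) * e ^+ 2); last by field; lra.
  rewrite ler_wpM2r// ler_pM ?sqr_ge0 ?invr_ge0//; first lra.
    by rewrite ler_pXn2r// nnegrE; lra.
  by rewrite lef_pV2.
have z5 : F ^+ 2 / (4 * (a / 4)) <= 1 / lo * F ^+ 2.
  rewrite (_ : F ^+ 2 / (4 * (a / 4)) = a^-1 * F ^+ 2); last by field; lra.
  by rewrite ler_wpM2r// div1r lef_pV2.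
have z3 : F ^+ 2 / (4 * Fb) = 1 / (4 * Fb) * F ^+ 2 by field; lra.
have w4 : h * (q * (b * e)) <= h * (a / 4 * q ^+ 2 + B ^+ 2 / lo * e ^+ 2).
  by rewrite ler_wpM2l; lra.
have w5 : h * (q * F) <= h * (a / 4 * q ^+ 2 + 1 / lo * F ^+ 2).
  by rewrite ler_wpM2l; lra.
have be : b * e ^+ 2 <= B * e ^+ 2 by rewrite ler_wpM2r.
have qa : h * (lo * q ^+ 2) <= h * (a * q ^+ 2).
  by rewrite ler_wpM2l// ?ler_wpM2r//; lra.
rewrite (_ : (A / h + B + Fb + h * B ^+ 2 / lo) * e ^+ 2 =
  A / h * e ^+ 2 + B * e ^+ 2 + Fb * e ^+ 2 + h * (B ^+ 2 / lo * e ^+ 2)); last by ring.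
rewrite (_ : (1 / (4 * Fb) + h / lo) * F ^+ 2 =
  1 / (4 * Fb) * F ^+ 2 + h * (1 / lo * F ^+ 2)); last by ring.
nra.
Qed.

(** The three smallness conditions make every energy coefficient at least [2 * eps], while the cross
    terms cost at most [eps] times the sum of squares. *)
Lemma axis_lyapunov_bounds (phi lo hi eps h d kappa q p e : R) :
  0 < phi -> 0 < lo -> lo <= d <= hi -> lo <= kappa <= hi -> 0 < h <= 1 ->
  0 < eps -> 4 * eps * hi <= 1 -> 4 * eps <= lo -> 4 * eps * phi <= 1 ->
  eps * (q ^+ 2 + p ^+ 2 + e ^+ 2) <= axis_lyapunov eps h phi d kappa q p e /\
  axis_lyapunov eps h phi d kappa q p e
    <= (hi + 1 / lo + 1 / phi + 2 * eps) * (q ^+ 2 + p ^+ 2 + e ^+ 2).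
Proof.
move=> phi0 lo0 /andP[ld dh] /andP[lk kh] /andP[h0 h1] eps0 ehi elo ephi.
have d0 : 0 < d by lra.
have e2 := sqr_ge0 e; have p2 := sqr_ge0 p; have q2 := sqr_ge0 q.
have ep : `|e * p| <= (e ^+ 2 + p ^+ 2) / 2.
  by have := sqr_ge0 (e + p); have := sqr_ge0 (e - p); rewrite ler_norml; nra.
have hqp : `|h * (q * p)| <= (q ^+ 2 + p ^+ 2) / 2.
  have : `|q * p| <= (q ^+ 2 + p ^+ 2) / 2.
    by have := sqr_ge0 (q + p); have := sqr_ge0 (q - p); rewrite ler_norml; nra.
  move=> qp; rewrite normrM (gtr0_norm h0); have := normr_ge0 (q * p); nra.
have epe : `|eps * (e * p)| <= eps * ((e ^+ 2 + p ^+ 2) / 2).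
  by rewrite normrM (gtr0_norm eps0) ler_wpM2l// ltW.
have qpe : `|eps * h * (q * p)| <= eps * ((q ^+ 2 + p ^+ 2) / 2).
  by rewrite -mulrA normrM (gtr0_norm eps0) ler_wpM2l// ltW.
have lop : p ^+ 2 / (2 * d) <= 1 / lo * p ^+ 2.
  rewrite mulrC ler_wpM2r// div1r lef_pV2 ?posrE//; lra.
have hip : 2 * eps * p ^+ 2 <= p ^+ 2 / (2 * d).
  by rewrite mulrC ler_wpM2l// -[leRHS]div1r ler_pdivlMr; nra.
have phe : 2 * eps * e ^+ 2 <= e ^+ 2 / (2 * phi).
  by rewrite mulrC ler_wpM2l// -[leRHS]div1r ler_pdivlMr; nra.
have phe' : e ^+ 2 / (2 * phi) <= 1 / phi * e ^+ 2.
  rewrite mulrC ler_wpM2r// div1r lef_pV2 ?posrE//; lra.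
have kq : 2 * eps * q ^+ 2 <= kappa * q ^+ 2 / 2.
  by rewrite [leRHS]mulrAC ler_wpM2r//; lra.
have kq' : kappa * q ^+ 2 / 2 <= hi * q ^+ 2.
  by rewrite mulrAC ler_wpM2r//; lra.
move: epe qpe; rewrite !ler_norml => /andP[epl epu] /andP[qpl qpu].
have ilo : 0 < 1 / lo by rewrite divr_gt0.
have iphi : 0 < 1 / phi by rewrite divr_gt0.
rewrite /axis_lyapunov; split; first nra.
rewrite (_ : (_ + 2 * eps) * _ =
  hi * q ^+ 2 + 1 / lo * p ^+ 2 + 1 / phi * e ^+ 2
  + (hi * (p ^+ 2 + e ^+ 2) + 1 / lo * (q ^+ 2 + e ^+ 2) + 1 / phi * (q ^+ 2 + p ^+ 2))
  + 2 * eps * (q ^+ 2 + p ^+ 2 + e ^+ 2)); last by ring.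
have : 0 <= hi * (p ^+ 2 + e ^+ 2) + 1 / lo * (q ^+ 2 + e ^+ 2) + 1 / phi * (q ^+ 2 + p ^+ 2).
  by rewrite !addr_ge0// mulr_ge0 ?addr_ge0//; lra.
nra.
Qed.

(** The constants are fixed in the order [h], [eps], [c], before any state. The assumptions on [w]
    and [F] concern sums over the axes because [Gamma] and the gyroscopic terms mix them. *)
Lemma strict_lyapunov (n : nat) (phi lo hi gam K Fb : R) :
  0 < phi -> 0 < lo -> 0 < hi -> 0 < gam -> 0 < K -> 0 < Fb ->
  exists eps h sigma c : R,
  [/\ [/\ 0 < eps, 0 < h <= 1, 0 < sigma & 0 < c],
      [/\ 4 * eps * hi <= 1, 4 * eps <= lo & 4 * eps * phi <= 1]
    & forall d kappa q p e w F : 'I_n -> R,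
      (forall i, lo <= d i <= hi) -> (forall i, lo <= kappa i <= hi) ->
      \sum_i w i ^+ 2 <= K * \sum_i e i ^+ 2 ->
      \sum_i F i ^+ 2 <= Fb * \sum_i p i ^+ 2 ->
      gam * (\sum_i e i ^+ 2) <= \sum_i e i * w i ->
      \sum_i p i * F i / d i <= sigma * \sum_i p i ^+ 2 ->
      \sum_i axis_dissipation eps h phi (d i) (kappa i)
                (q i) (p i) (e i) (w i) (F i)
      <= - c * \sum_i (q i ^+ 2 + p i ^+ 2 + e i ^+ 2)].
Proof.
move=> phi0 lo0 hi0 gam0 K0 Fb0.
pose l := lo * lo; have l0 : 0 < l by rewrite mulr_gt0.
(* With [l] a lower bound of [d * kappa], the terms in [F] then cost at most [1/4 + 1/8] of the sum
   of [p ^+ 2], against an available [5/8]. *)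
pose h := Num.min (1 / 8) (l / (8 * Fb)).
have h0 : 0 < h by rewrite lt_min !divr_gt0// mulr_gt0.
have h8 : h <= 1 / 8 by rewrite ge_min lexx.
have hF : h / l * Fb <= 1 / 8.
  have : h <= l / (8 * Fb) by rewrite ge_min lexx orbT.
  rewrite ler_pdivlMr ?mulr_gt0// => hl.
  by rewrite mulrAC ler_pdivrMr//; lra.
pose B := hi / phi; have B0 : 0 < B by rewrite divr_gt0.
(* [N] is the coefficient of [e ^+ 2] in [axis_cross_terms]; [N'] adds the contribution of [w]. *)
pose N := hi * hi / h + B + Fb + h * B ^+ 2 / l.
have N0 : 0 < N.
  by rewrite !(addr_gt0, divr_gt0, mulr_gt0, exprn_gt0).
pose N' := N + phi ^+ 2 * K.
have N'0 : 0 < N' by rewrite addr_gt0// mulr_gt0// exprn_gt0.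
(* The first bound leaves half of the dissipation [gam] on [e]; the others are the conditions of
   [axis_lyapunov_bounds]. *)
pose eps := Num.min (gam / (2 * N'))
  (Num.min (1 / (4 * hi)) (Num.min (lo / 4) (1 / (4 * phi)))).
have eps0 : 0 < eps by rewrite !lt_min !divr_gt0// mulr_gt0.
have eN : eps * N' <= gam / 2.
  have : eps <= gam / (2 * N') by rewrite ge_min lexx.
  by rewrite ler_pdivlMr ?mulr_gt0//; lra.
have e1 : eps <= 1 / (4 * hi) by rewrite !ge_min lexx orbT.
have e2 : eps <= lo / 4 by rewrite !ge_min lexx !orbT.
have e3 : eps <= 1 / (4 * phi) by rewrite !ge_min lexx !orbT.
(* The remaining decay rates in [e], [p] and [q]; the one in [p] is [eps / 4] minus
   [sigma = eps / 8]. *)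
pose c := Num.min (gam / 2) (Num.min (eps / 8) (eps * (h * l / 4))).
have c0 : 0 < c by rewrite !lt_min !divr_gt0// !mulr_gt0// invr_gt0.
have c1 : c <= gam / 2 by rewrite !ge_min lexx.
have c2 : c <= eps / 8 by rewrite !ge_min lexx orbT.
have c3 : c <= eps * (h * l / 4) by rewrite !ge_min lexx !orbT.
exists eps, h, (eps / 8), c; split.
- by split; rewrite ?h0 ?divr_gt0//=; lra.
- move: e1 e3; rewrite !ler_pdivlMr ?mulr_gt0// => e1 e3; split; lra.
move=> d kappa q p e w F dP kP wP FP gP sP.
have split_axis i : axis_dissipation eps h phi (d i) (kappa i)
    (q i) (p i) (e i) (w i) (F i) <=
  eps * ((h - 3 / 4) * p i ^+ 2 + phi ^+ 2 * w i ^+ 2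
   + (1 / (4 * Fb) + h / l) * F i ^+ 2 - h * l / 4 * q i ^+ 2 + N * e i ^+ 2)
  + p i * F i / d i - e i * w i.
  have /andP[ld dh] := dP i; have /andP[lk kh] := kP i.
  have d0 : 0 < d i by lra.
  have lab : l <= d i * kappa i <= hi * hi.
    by rewrite !ler_pM//; lra.
  have bB : 0 <= d i / phi <= B.
    by apply/andP; split; [rewrite divr_ge0// ltW|rewrite /B ler_wpM2r// invr_ge0 ltW].
  have := axis_cross_terms phi (q i) (p i) (e i) (w i) (F i) h0 l0 Fb0 lab bB.
  move=> /(ler_wpM2l (ltW eps0)) cross.
  rewrite /axis_dissipation lerD2r lerD2r; apply: le_trans cross.
  by rewrite le_eqVlt; apply/orP; left; apply/eqP; ring.
apply: le_trans (ler_sum _ (fun i _ => split_axis i)) _.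
rewrite sumrB !big_split /= -mulr_sumr !big_split /= sumrN -!mulr_sumr.
rewrite !mulNr.
move: wP FP gP sP.
have : 0 <= \sum_i q i ^+ 2 by apply: sumr_ge0 => i _; exact: sqr_ge0.
have : 0 <= \sum_i p i ^+ 2 by apply: sumr_ge0 => i _; exact: sqr_ge0.
have : 0 <= \sum_i e i ^+ 2 by apply: sumr_ge0 => i _; exact: sqr_ge0.
move: (\sum_i q i ^+ 2) (\sum_i p i ^+ 2) (\sum_i e i ^+ 2) => Q P E.
move: (\sum_i w i ^+ 2) (\sum_i F i ^+ 2) (\sum_i e i * w i) => SW SF EW.
move: (\sum_i p i * F i / d i) => PF E0 P0 Q0 wP FP gP sP.
have wP' : phi ^+ 2 * SW <= phi ^+ 2 * (K * E) by rewrite ler_wpM2l ?sqr_ge0.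
have FP' : (1 / (4 * Fb) + h / l) * SF <= 3 / 8 * P.
  have hl0 : 0 < h / l by rewrite divr_gt0.
  have k0 : 0 < 1 / (4 * Fb) by rewrite divr_gt0// mulr_gt0.
  apply: le_trans (_ : (1 / (4 * Fb) + h / l) * (Fb * P) <= _).
    by rewrite ler_wpM2l// addr_ge0 ?ltW.
  rewrite mulrA ler_wpM2r// mulrDl (_ : 1 / (4 * Fb) * Fb = 1 / 4); last by field; lra.
  lra.
have hP : (h - 3 / 4) * P <= - (5 / 8) * P by rewrite ler_wpM2r//; lra.
have body : eps * ((h - 3 / 4) * P + phi ^+ 2 * SW + (1 / (4 * Fb) + h / l) * SF
    - h * l / 4 * Q + N * E) <= eps * (- (1 / 4) * P - h * l / 4 * Q + N' * E).
  rewrite ler_wpM2l ?(ltW eps0)// /N'; lra.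
have NE : eps * N' * E <= gam / 2 * E by rewrite ler_wpM2r.
have cE : c * E <= gam / 2 * E by rewrite ler_wpM2r.
have cP : c * P <= eps / 8 * P by rewrite ler_wpM2r.
have cQ : c * Q <= eps * (h * l / 4) * Q by rewrite ler_wpM2r.
lra.
Qed.

End StrictLyapunov.

(** * Quadratic estimates for matrices, the max norm, and derivatives of linear functionals *)

Section LinearAlgebra.
Variable R : realType.

(** A Cauchy-Schwarz bound with an unspecified constant, by induction from
    [(u + v) ^+ 2 <= 2 * u ^+ 2 + 2 * v ^+ 2]. *)
Lemma sqr_dotprod_le (n : nat) (b : 'I_n -> R) :
  exists2 K, 0 < K & forall x : 'I_n -> R,
    (\sum_i b i * x i) ^+ 2 <= K * \sum_i x i ^+ 2.
Proof.
elim: n b => [|n IHn] b.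
  by exists 1 => // x; rewrite !big_ord0 expr0n mulr0.
have [K K0 KP] := IHn (fun i => b (lift ord0 i)).
exists (2 * b ord0 ^+ 2 + 2 * K) => [|x].
  by rewrite ltr_wpDl ?mulr_gt0// mulr_ge0// sqr_ge0.
rewrite !big_ord_recl; have := KP (fun i => x (lift ord0 i)).
set S := \sum_(i < n) _; set T := \sum_(i < n) _ => ST.
have T0 : 0 <= T by apply: sumr_ge0 => i _; exact: sqr_ge0.
have x2 := sqr_ge0 (x ord0); have b2 := sqr_ge0 (b ord0).
apply: le_trans (_ : 2 * (b ord0 * x ord0) ^+ 2 + 2 * S ^+ 2 <= _).
  by have := sqr_ge0 (b ord0 * x ord0 - S); nra.
rewrite exprMn.
have bT : 0 <= b ord0 ^+ 2 * T by exact: mulr_ge0.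
have Kx : 0 <= K * x ord0 ^+ 2 by rewrite mulr_ge0// ltW.
nra.
Qed.

Lemma sqr_mulmx_le (m n : nat) (A : 'M[R]_(m, n)) :
  exists2 K, 0 < K & forall x : 'cV[R]_n,
    \sum_i (A *m x) i ord0 ^+ 2 <= K * \sum_i x i ord0 ^+ 2.
Proof.
have /choice[K KP] : forall i, exists K, 0 < K /\ forall x : 'cV[R]_n,
    (A *m x) i ord0 ^+ 2 <= K * \sum_i x i ord0 ^+ 2.
  move=> i; have [K K0 KP] := sqr_dotprod_le (A i); exists K; split=> // x.
  by rewrite mxE; exact: KP (fun j => x j ord0).
(* The summand 1 keeps the constant positive even when there are no rows. *)
exists (1 + \sum_i K i) => [|x].
  by rewrite ltr_pwDl// sumr_ge0// => i _; apply: ltW; exact: (KP i).1.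
have S0 : 0 <= \sum_i x i ord0 ^+ 2 by apply: sumr_ge0 => i _; exact: sqr_ge0.
rewrite mulrDl mul1r mulr_suml -[leLHS]add0r lerD// ler_sum// => i _.
exact: (KP i).2.
Qed.

(** Stands in for the smallest eigenvalue, using only the invertibility of [A] and no spectral
    theorem. *)
Lemma posdefmx_coercive (n : nat) (A : 'M[R]_n) : posdefmx A ->
  exists2 gam, 0 < gam & forall x : 'cV[R]_n,
    gam * (\sum_i x i ord0 ^+ 2) <= \sum_i x i ord0 * (A *m x) i ord0.
Proof.
move=> A_posdef; have uA := posdefmx_unit A_posdef.
case: A_posdef => Asym Apos.
have dotE (u v : 'cV[R]_n) : (u^T *m v) ord0 ord0 = \sum_i u i ord0 * v i ord0.
  by rewrite mxE; apply: eq_bigr => i _; rewrite mxE.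
have A_ge0 (x : 'cV[R]_n) : 0 <= (x^T *m A *m x) ord0 ord0.
  have [->|/Apos/ltW//] := eqVneq x 0.
  by rewrite mulmx0 mxE.
have [K K0 KP] := sqr_mulmx_le (invmx A).
(* From [2 x y <= x ^+ 2 + y ^+ 2] and the bound [K] on the inverse, the form of [A^-1] is at most
   [C * N]. *)
pose C := (1 + K) / 2; have C0 : 0 < C by rewrite divr_gt0// addr_gt0.
exists C^-1 => [|x]; first by rewrite invr_gt0.
set N := \sum_i _ ^+ 2; rewrite -dotE.
(* Positivity of the form at [x - C^-1 A^-1 x] bounds it from below at [x]. *)
pose y := invmx A *m x.
have yAy : (y^T *m x) ord0 ord0 <= C * N.
  rewrite dotE /C mulrAC ler_pdivlMr// mulrDl mul1r.
  apply: le_trans (_ : \sum_i x i ord0 ^+ 2 + \sum_i y i ord0 ^+ 2 <= _).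
    rewrite mulr_suml -big_split ler_sum// => i _ /=.
    by have := sqr_ge0 (x i ord0 - y i ord0); nra.
  by rewrite lerD2l KP.
have Ay : A *m y = x by rewrite /y mulKVmx.
have xAy : (x^T *m A *m y) ord0 ord0 = N.
  by rewrite -mulmxA Ay dotE; apply: eq_bigr => i _; rewrite expr2.
have yAx : (y^T *m A *m x) ord0 ord0 = N.
  have : (x^T *m A *m y)^T = y^T *m A *m x by rewrite !trmx_mul trmxK Asym mulmxA.
  by move=> <-; rewrite mxE.
have := A_ge0 (x - C^-1 *: y).
have entB (u v : 'M[R]_1) : (u - v) ord0 ord0 = u ord0 ord0 - v ord0 ord0.
  by rewrite !mxE.
have entZ a (u : 'M[R]_1) : (a *: u) ord0 ord0 = a * u ord0 ord0 by rewrite mxE.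
rewrite [(x - _)^T]linearB /= [(_ *: y)^T]linearZ /= !mulmxBl !mulmxBr.
rewrite -!scalemxAl -!scalemxAr !entB !entZ xAy yAx -[y^T *m A *m y]mulmxA Ay.
rewrite -mulmxA => ge0.
have : C^-1 * (C^-1 * (y^T *m x) ord0 ord0) <= C^-1 * N.
  by rewrite ler_wpM2l ?invr_ge0 ?(ltW C0)// ler_pdivrMl.
lra.
Qed.

Lemma sqr_norm_le (n : nat) (x : 'cV[R]_n) : `|x| ^+ 2 <= \sum_i x i ord0 ^+ 2.
Proof.
have S0 : 0 <= \sum_i x i ord0 ^+ 2 by apply: sumr_ge0 => i _; exact: sqr_ge0.
have [x0|/mx_norm_neq0[[i j] /= xij]] := eqVneq (mx_norm x) 0.
  by rewrite -[`|x|]/(mx_norm x) x0 expr0n.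
rewrite -[`|x|]/(mx_norm x) xij ord1 real_normK ?num_real//.
by rewrite (bigD1 i)//= lerDl sumr_ge0// => k _; exact: sqr_ge0.
Qed.

Lemma coord_le_norm (n : nat) (x : 'cV[R]_n) i : `|x i ord0| <= `|x|.
Proof.
rewrite -[`|x|]/(mx_norm x) mx_normrE.
exact: (le_bigmax _ (fun ij : 'I_n * 'I_1 => `|x ij.1 ij.2|) (i, ord0)).
Qed.

Lemma norm_le_coord (n : nat) (x : 'cV[R]_n) (r : R) : 0 <= r ->
  (forall i, `|x i ord0| <= r) -> `|x| <= r.
Proof.
move=> r0 xr; rewrite -[`|x|]/(mx_norm x) mx_normrE.
by apply: bigmax_le => // -[i j] _; rewrite ord1.
Qed.

Lemma sum_sqr_le_norm (n : nat) (x : 'cV[R]_n) :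
  \sum_i x i ord0 ^+ 2 <= n%:R * `|x| ^+ 2.
Proof.
have -> : n%:R * `|x| ^+ 2 = \sum_(i < n) `|x| ^+ 2.
  by rewrite sumr_const card_ord mulr_natl.
rewrite ler_sum// => i _.
by rewrite -real_normK ?num_real// ler_pXn2r ?nnegrE// coord_le_norm.
Qed.

Lemma continuous_sum (T : topologicalType) (n : nat) (F : 'I_n -> T -> R) :
  (forall i, continuous (F i)) -> continuous (fun x => \sum_i F i x).
Proof.
elim: n F => [|n IHn] F cF.
  by under eq_fun do rewrite big_ord0; move=> x; exact: cvg_cst.
under eq_fun do rewrite big_ord_recl; move=> x.
by apply: cvgD; [exact: cF|apply: IHn => i; exact: cF].
Qed.

(** Linearity is assumed exactly in the shape of a difference quotient, so [L] commutes with it and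
    continuity passes to the limit. *)
Lemma is_derive_linear (V : normedModType R) (L : V -> R) (x : R -> V) (t : R) dx :
  continuous L -> (forall k u v, L (k *: (u - v)) = k * (L u - L v)) ->
  is_derive t (1 : R) x dx -> is_derive t (1 : R) (L \o x) (L dx).
Proof.
move=> cL linL [dx1 dx2].
have h : (fun h : R => h^-1 *: (((L \o x) \o shift t) (h *: (1 : R)) - (L \o x) t))
    @ 0^' --> L dx.
  have -> : (fun h : R => h^-1 *: (((L \o x) \o shift t) (h *: (1 : R)) - (L \o x) t)) =
    L \o (fun h : R => h^-1 *: ((x \o shift t) (h *: (1 : R)) - x t)).
    by apply/funext => h /=; rewrite linL.
  apply: continuous_cvg; first exact: cL.
  by rewrite -dx2; exact: dx1.
split; first by apply/cvg_ex; exists (L dx).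
by apply/cvg_lim.
Qed.

End LinearAlgebra.

(** * The rotational dynamics in angle and rate coordinates *)

Section ClosedLoop.
Variable R : realType.

(** Indices are 0-based here, unlike in [coord1]: angles sit at even positions and rates at odd
    ones. *)
Definition angle (x : 'cV[R]_6) (i : 'I_3) : R := x (inord (2 * i)) ord0.
Definition rate (x : 'cV[R]_6) (i : 'I_3) : R := x (inord (2 * i).+1) ord0.

Lemma big_ord3 (F : 'I_3 -> R) :
  \sum_i F i = F (inord 0) + F (inord 1) + F (inord 2).
Proof.
rewrite !big_ord_recr big_ord0 /= add0r.
by congr (F _ + F _ + F _); apply: val_inj; rewrite /= inordK.
Qed.

Lemma attitudeE (x : 'cV[R]_6) i : attitude x i ord0 = angle x i.
Proof.
rewrite /attitude /vec3 /coord1 mxE /angle.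
by case: i => [[|[|[|//]]] ?].
Qed.

Lemma sum_sqr_coord6 (x : 'cV[R]_6) :
  \sum_i x i ord0 ^+ 2 = \sum_i angle x i ^+ 2 + \sum_i rate x i ^+ 2.
Proof.
have sum6 (F : 'I_6 -> R) : \sum_i F i = F (inord 0) + F (inord 1) + F (inord 2)
    + F (inord 3) + F (inord 4) + F (inord 5).
  rewrite !big_ord_recr big_ord0 /= add0r.
  by congr (F _ + F _ + F _ + F _ + F _ + F _); apply: val_inj; rewrite /= inordK.
by rewrite sum6 !big_ord3 /angle /rate !inordK//=; ring.
Qed.

Variable p : quadrotor R.

Definition input_gain (i : 'I_3) : R := [:: b1 p; b2 p; b3 p]`_i.

(** The gyroscopic terms, with the value of [g] abstracted to a scalar [gu] so that estimates are
    uniform in it. *)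
Definition coupling (x : 'cV[R]_6) (gu : R) (i : 'I_3) : R :=
  [:: a1 p * rate x (inord 1) * rate x (inord 2) - a2 p * rate x (inord 1) * gu;
      a3 p * rate x (inord 0) * rate x (inord 2) + a4 p * rate x (inord 0) * gu;
      a5 p * rate x (inord 0) * rate x (inord 1)]`_i.

Variables (g : 'cV[R]_4 -> R) (u1 : R -> R) (kp : 'cV[R]_3).

Lemma rotational_angle (t : R) (x : 'cV[R]_6) (v : 'cV[R]_3) i :
  angle (rotational p g kp u1 t x v) i = rate x i.
Proof.
rewrite /angle /rate /rotational /vec6 mxE /coord1.
by case: i => [[|[|[|//]]] ?] /=; rewrite inordK.
Qed.

Lemma rotational_rate (t : R) (x : 'cV[R]_6) (v : 'cV[R]_3) i :
  rate (rotational p g kp u1 t x v) i =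
  input_gain i * (v i ord0 - kp i ord0 * angle x i)
  + coupling x (g (quad_input kp (u1 t) x v)) i.
Proof.
rewrite /angle /rate /rotational /vec6 /coord1 /coupling /input_gain.
have E (w : 'cV[R]_3) k (h : (k < 3)%N) : w (Ordinal h) ord0 = w (inord k) ord0.
  by congr (w _ _); apply: val_inj; rewrite /= inordK.
set gu := g _.
by case: i => [[|[|[|//]]] h]; rewrite mxE /rate !inordK//= !E; ring.
Qed.

(* The gyroscopic torques do no work; only the cubic term survives, because
   b1 = l / Jx and b2 = l / Jy carry the arm length while b3 = 1 / Jz does not. *)
Lemma coupling_power (x : 'cV[R]_6) (gu : R) :
  [/\ 0 < Jx p, 0 < Jy p & 0 < Jz p] -> 0 < arm p ->
  \sum_i rate x i * coupling x gu i / input_gain i =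
  (Jx p - Jy p) * (1 - 1 / arm p)
  * (rate x (inord 0) * rate x (inord 1) * rate x (inord 2)).
Proof.
case=> x0 y0 z0 l0.
rewrite big_ord3 /coupling /input_gain !inordK//=.
rewrite /a1 /a2 /a3 /a4 /a5 /b1 /b2 /b3.
field.
by do ?split; rewrite ?gt_eqF.
Qed.

(** Each component is one rate times a factor that stays bounded on the unit ball. *)
Lemma coupling_bound (G : R) : 0 <= G -> exists2 Fb, 0 < Fb &
  forall (x : 'cV[R]_6) (gu : R), `|x| <= 1 -> `|gu| <= G ->
    \sum_i coupling x gu i ^+ 2 <= Fb * \sum_i rate x i ^+ 2.
Proof.
move=> G0.
have H (a b gu r1 r2 : R) : `|r2| <= 1 -> `|gu| <= G ->
    (a * r1 * r2 + b * r1 * gu) ^+ 2 <= (`|a| + `|b| * G) ^+ 2 * r1 ^+ 2.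
  move=> r21 guG.
  rewrite (_ : a * r1 * r2 + b * r1 * gu = (a * r2 + b * gu) * r1); last by ring.
  rewrite exprMn ler_wpM2r ?sqr_ge0// -[leLHS]real_normK ?num_real//.
  rewrite ler_pXn2r ?nnegrE// ?addr_ge0 ?mulr_ge0//.
  apply: le_trans (ler_normD _ _) _; rewrite !normrM lerD//.
    by rewrite ler_piMr.
  by rewrite ler_wpM2l.
pose c1 := (`|a1 p| + `|a2 p| * G) ^+ 2.
pose c2 := (`|a3 p| + `|a4 p| * G) ^+ 2.
(* Yaw has no term in [gu]; the zero coefficient lets [H] apply to it as well. *)
pose c3 := (`|a5 p| + `|0 : R| * G) ^+ 2.
have [c10 c20 c30] : [/\ 0 <= c1, 0 <= c2 & 0 <= c3] by split; exact: sqr_ge0.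
exists (1 + c1 + c2 + c3) => [|x gu x1 guG]; first by lra.
have r1 i : `|rate x i| <= 1 by apply: le_trans x1; exact: coord_le_norm.
rewrite !big_ord3 /coupling !inordK//=.
have := H (a1 p) (- a2 p) gu (rate x (inord 1)) (rate x _) (r1 (inord 2)) guG.
have := H (a3 p) (a4 p) gu (rate x (inord 0)) (rate x _) (r1 (inord 2)) guG.
have := H (a5 p) 0 gu (rate x (inord 0)) (rate x _) (r1 (inord 1)) guG.
rewrite -/c3 -/c2 normrN -/c1 [0 * _]mul0r [0 * gu]mul0r addr0 !mulNr.
have := sqr_ge0 (rate x (inord 0)); have := sqr_ge0 (rate x (inord 1)).
have := sqr_ge0 (rate x (inord 2)).
nra.
Qed.

End ClosedLoop.

(** * The Lyapunov function of the interconnection and its decay *)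

Section ControlledQuadrotor.
Variable R : realType.

Lemma is_derive_axis_lyapunov (eps h phi d kappa w F : R) (q p e : R -> R) (t : R) :
  d != 0 -> phi != 0 ->
  is_derive t (1 : R) q (p t) ->
  is_derive t (1 : R) p (d * (e t / phi - kappa * q t) + F) ->
  is_derive t (1 : R) e (- phi * w - p t) ->
  is_derive t (1 : R) (fun s => axis_lyapunov eps h phi d kappa (q s) (p s) (e s))
    (axis_dissipation eps h phi d kappa (q t) (p t) (e t) w F).
Proof.
move=> d0 phi0 dq dp de; rewrite /axis_lyapunov.
have sq (f : R -> R) df : is_derive t (1 : R) f df ->
    is_derive t (1 : R) (fun s => f s ^+ 2) (2 * f t * df).
  move=> ff; rewrite (_ : (fun s => _) = f * f); last by apply/funext => s /=; rewrite expr2.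
  by apply: is_derive_eq; rewrite /GRing.scale /=; ring.
have mk (k : R) (f : R -> R) df : is_derive t (1 : R) f df ->
    is_derive t (1 : R) (fun s => k * f s) (k * df).
  by move=> ff; exact: (is_deriveZ k ff).
have pr (f f' : R -> R) df df' : is_derive t (1 : R) f df ->
    is_derive t (1 : R) f' df' -> is_derive t (1 : R) (fun s => f s * f' s) (f t * df' + f' t * df).
  by move=> ff ff'; exact: (is_deriveM ff ff').
have ad (f f' : R -> R) df df' : is_derive t (1 : R) f df ->
    is_derive t (1 : R) f' df' -> is_derive t (1 : R) (fun s => f s + f' s) (df + df').
  by move=> ff ff'; exact: (is_deriveD ff ff').
(* Divisions become constant factors on the left, the shape that the rules [mk], [sq], [pr] and [ad]
   compose on. *)
rewrite (_ : (fun s => _) = fun s => (2 * d)^-1 * p s ^+ 2 + kappa / 2 * q s ^+ 2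
   + (2 * phi)^-1 * e s ^+ 2 + eps * (e s * p s) + (eps * h) * (q s * p s)); last first.
  by apply/funext => s; ring.
have H := ad _ _ _ _ (ad _ _ _ _ (ad _ _ _ _ (ad _ _ _ _
  (mk (2 * d)^-1 _ _ (sq _ _ dp)) (mk (kappa / 2) _ _ (sq _ _ dq)))
  (mk (2 * phi)^-1 _ _ (sq _ _ de))) (mk eps _ _ (pr _ _ _ _ de dp)))
  (mk (eps * h) _ _ (pr _ _ _ _ dq dp)).
apply: (is_derive_eq H).
rewrite /axis_dissipation; field.
by rewrite d0 phi0.
Qed.

Variables (p : quadrotor R) (g : 'cV[R]_4 -> R) (u1 : R -> R) (kp : 'cV[R]_3).
Variables (n : nat) (C : 'M[R]_(3, n)) (phi : R).
Implicit Types X : 'cV[R]_6 * 'cV[R]_n.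

Lemma norm_pairE X : `|X| = Num.max `|X.1| `|X.2|.
Proof. by []. Qed.

Definition error X : 'cV[R]_3 := phi *: (C *m X.2) - attitude X.1.

Definition state_size X : R :=
  \sum_i (angle X.1 i ^+ 2 + rate X.1 i ^+ 2 + error X i ord0 ^+ 2).

Lemma angle_continuous i : continuous (fun X => angle X.1 i).
Proof.
move=> X; apply: (@continuous_comp _ _ _ fst (fun M : 'cV[R]_6 => M _ ord0)).
  exact: cvg_fst.
exact: coord_continuous.
Qed.

Lemma rate_continuous i : continuous (fun X => rate X.1 i).
Proof.
move=> X; apply: (@continuous_comp _ _ _ fst (fun M : 'cV[R]_6 => M _ ord0)).
  exact: cvg_fst.
exact: coord_continuous.
Qed.

Lemma errorE X i : error X i ord0 = phi * (\sum_j C i j * X.2 j ord0) - angle X.1 i.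
Proof. by rewrite /error -attitudeE !mxE. Qed.

Lemma error_continuous i : continuous (fun X => error X i ord0).
Proof.
move=> X; under eq_fun do rewrite errorE.
apply: cvgB; last exact: angle_continuous.
apply: cvgM; first exact: cvg_cst.
apply: continuous_sum => j {}X; apply: cvgM; first exact: cvg_cst.
apply: (@continuous_comp _ _ _ snd (fun M : 'cV[R]_n => M _ ord0)).
  exact: cvg_snd.
exact: coord_continuous.
Qed.

Lemma angle_linear i (k : R) X Y :
  angle (k *: (X - Y)).1 i = k * (angle X.1 i - angle Y.1 i).
Proof. by rewrite /angle !mxE. Qed.

Lemma rate_linear i (k : R) X Y :
  rate (k *: (X - Y)).1 i = k * (rate X.1 i - rate Y.1 i).
Proof. by rewrite /rate !mxE. Qed.

Lemma error_linear i (k : R) X Y :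
  error (k *: (X - Y)) i ord0 = k * (error X i ord0 - error Y i ord0).
Proof.
rewrite !errorE angle_linear.
rewrite (_ : \sum_j C i j * (k *: (X - Y)).2 j ord0 =
  k * (\sum_j C i j * X.2 j ord0 - \sum_j C i j * Y.2 j ord0)); first by ring.
rewrite -sumrB mulr_sumr; apply: eq_bigr => j _.
by rewrite !mxE; ring.
Qed.

(** The angles and the error determine [C z] since [phi] is nonzero, and [D] recovers the controller
    state [z] from it. *)
Lemma norm_state_size (D : 'M[R]_(n, 3)) : D *m C = 1%:M -> phi != 0 ->
  exists m M, [/\ 0 < m, 0 < M & forall X,
    m * `|X| ^+ 2 <= state_size X /\ state_size X <= M * `|X| ^+ 2].
Proof.
move=> DC phi0.
have [K K0 KP] := sqr_mulmx_le C; have [L L0 LP] := sqr_mulmx_le D.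
have f2 : 0 < phi ^+ 2 by rewrite exprn_even_gt0.
pose V X := \sum_i (C *m X.2) i ord0 ^+ 2.
have V0 X : 0 <= V X by apply: sumr_ge0 => i _; exact: sqr_ge0.
have VP X : V X <= K * (n%:R * `|X| ^+ 2).
  apply: le_trans (KP _) _; rewrite ler_wpM2l ?(ltW K0)//.
  apply: le_trans (sum_sqr_le_norm _) _; rewrite ler_wpM2l//.
  by rewrite ler_pXn2r ?nnegrE// norm_pairE le_max lexx orbT.
have x2P X : `|X.2| ^+ 2 <= L * V X.
  apply: le_trans (sqr_norm_le _) _.
  by apply: le_trans (LP _); rewrite mulmxA DC mul1mx.
have x1P X : `|X.1| ^+ 2 <= \sum_i angle X.1 i ^+ 2 + \sum_i rate X.1 i ^+ 2.
  by rewrite -sum_sqr_coord6; exact: sqr_norm_le.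
have x1M X : \sum_i angle X.1 i ^+ 2 + \sum_i rate X.1 i ^+ 2 <= 6 * `|X| ^+ 2.
  rewrite -sum_sqr_coord6; apply: le_trans (sum_sqr_le_norm _) _.
  by rewrite ler_wpM2l// ler_pXn2r ?nnegrE// norm_pairE le_max lexx.
have sE X : state_size X = \sum_i angle X.1 i ^+ 2 + \sum_i rate X.1 i ^+ 2
    + \sum_i error X i ord0 ^+ 2 by rewrite /state_size !big_split.
have erE X i : error X i ord0 = phi * (C *m X.2) i ord0 - angle X.1 i.
  by rewrite /error -attitudeE mxE; congr (_ + _); rewrite mxE.
have eV X : \sum_i error X i ord0 ^+ 2 <= 2 * phi ^+ 2 * V X + 2 * \sum_i angle X.1 i ^+ 2.
  rewrite !mulr_sumr -big_split; apply: ler_sum => i _ /=; rewrite erE.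
  by have := sqr_ge0 (phi * (C *m X.2) i ord0 + angle X.1 i); lra.
have Ve X : phi ^+ 2 * V X <= 2 * \sum_i error X i ord0 ^+ 2 + 2 * \sum_i angle X.1 i ^+ 2.
  rewrite !mulr_sumr -big_split; apply: ler_sum => i _ /=; rewrite erE.
  by have := sqr_ge0 (phi * (C *m X.2) i ord0 - 2 * angle X.1 i); lra.
have S0 (h : 'I_3 -> R) : 0 <= \sum_i h i ^+ 2 by apply: sumr_ge0 => i _; exact: sqr_ge0.
(* The 1 serves the plant state, the quotient the controller state through [x2P] and [Ve]. *)
pose N := 1 + 2 * L / phi ^+ 2.
have N0 : 0 < N by rewrite /N ltr_pwDl// ltW// divr_gt0// mulr_gt0.
exists N^-1, (18 + 2 * phi ^+ 2 * (K * n%:R)); split; first by rewrite invr_gt0.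
  have Kn : 0 <= K * n%:R by rewrite mulr_ge0// ltW.
  have := mulr_ge0 (ltW f2) Kn; lra.
move=> X; have := S0 (angle X.1); have := S0 (rate X.1); have := S0 (fun i => error X i ord0).
move=> eS rS aS; split; last first.
  have := x1M X; have := eV X.
  have := ler_wpM2l (ltW f2) (VP X); rewrite sE; lra.
rewrite ler_pdivrMl//; have s0 : 0 <= state_size X by rewrite sE; lra.
have c1 : `|X.1| ^+ 2 <= N * state_size X.
  apply: le_trans (x1P X) _; apply: le_trans (_ : 1 * state_size X <= _).
    by rewrite mul1r sE; lra.
  by rewrite ler_wpM2r// lerDl ltW// divr_gt0// mulr_gt0.
have c2 : `|X.2| ^+ 2 <= N * state_size X.
  apply: le_trans (x2P X) _.
  apply: le_trans (_ : L * (2 * state_size X / phi ^+ 2) <= _).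
    rewrite ler_wpM2l ?(ltW L0)// ler_pdivlMr// mulrC.
    by apply: le_trans (Ve X) _; rewrite sE; lra.
  rewrite (_ : L * _ = 2 * L / phi ^+ 2 * state_size X); last by ring.
  by rewrite ler_wpM2r// lerDr.
by rewrite norm_pairE maxEle; case: ifP.
Qed.

(** For states in the unit ball the input stays in a fixed ball: [U] bounds the thrust, [|kp|] the
    inner feedback, [1 + K * n%:R] the controller output. *)
Lemma input_bounded :
  (forall r : R, [bounded g u | u in [set u : 'cV[R]_4 | `|u| <= r]]) ->
  [bounded u1 t | t in [set t : R | 0 <= t]] ->
  exists2 G, 0 <= G & forall (t : R) X, 0 <= t -> `|X| <= 1 ->
    `|g (quad_input kp (u1 t) X.1 (C *m X.2))| <= G.
Proof.
move=> hg /ex_strict_bound_gt0[U U0 UP].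
have [K K0 KP] := sqr_mulmx_le C.
pose r := U + (`|kp| + (1 + K * n%:R)).
have r0 : 0 <= K * n%:R by rewrite mulr_ge0// ltW.
have [G G0 GP] := ex_strict_bound_gt0 (hg r).
exists G => [|t X t0 X1]; first exact: ltW.
apply: ltW; apply: GP => /=.
have X1' : `|X.1| <= 1 by apply: le_trans X1; rewrite norm_pairE le_max lexx.
have X2' : `|X.2| <= 1 by apply: le_trans X1; rewrite norm_pairE le_max lexx orbT.
apply: norm_le_coord => [|i]; first by rewrite /r !addr_ge0// ltW.
rewrite /quad_input mxE; case: splitP => j _.
  rewrite ord1 mxE eqxx mulr1n; apply: le_trans (_ : U <= _).
    by apply: ltW; exact: UP.
  by rewrite lerDl !addr_ge0.
apply: le_trans (_ : `|kp| + (1 + K * n%:R) <= _); last by rewrite lerDr ltW.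
rewrite mxE; apply: le_trans (ler_normD _ _) _; rewrite lerD//.
  rewrite mxE normrN mul_diag_mx mxE attitudeE normrM mxE.
  rewrite -[leRHS]mulr1 ler_pM ?coord_le_norm//.
  by apply: le_trans X1'; exact: coord_le_norm.
(* A bound [y ^+ 2 <= k] yields [|y| <= 1 + k], which avoids a square root. *)
have : (C *m X.2) j ord0 ^+ 2 <= K * n%:R.
  apply: le_trans (_ : \sum_i (C *m X.2) i ord0 ^+ 2 <= _).
    by rewrite (bigD1 j)//= lerDl sumr_ge0// => k _; exact: sqr_ge0.
  apply: le_trans (KP _) _; rewrite ler_wpM2l ?(ltW K0)//.
  apply: le_trans (sum_sqr_le_norm _) _; rewrite ler_piMr// exprn_ile1//.
rewrite ler_norml; nra.
Qed.

(** Per axis, the potential part is a completed square of [kp eta^2 / 2 - eta v + phi v^2 / 2];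
    [1 / phi] is the static gain of the controller. *)
Definition closed_loop_lyapunov (eps h : R) X : R :=
  \sum_i axis_lyapunov eps h phi (input_gain p i) (kp i ord0 - 1 / phi)
    (angle X.1 i) (rate X.1 i) (error X i ord0).

Lemma closed_loop_lyapunov_continuous (eps h : R) :
  continuous (closed_loop_lyapunov eps h).
Proof.
apply: continuous_sum => i X; rewrite /axis_lyapunov.
have cq := @angle_continuous i X; have cp := @rate_continuous i X.
have ce := @error_continuous i X.
have cM (f f' : 'cV[R]_6 * 'cV[R]_n -> R) : {for X, continuous f} ->
    {for X, continuous f'} -> {for X, continuous (fun Y => f Y * f' Y)}.
  by move=> cf cf'; exact: cvgM.
have cD (f f' : 'cV[R]_6 * 'cV[R]_n -> R) : {for X, continuous f} ->
    {for X, continuous f'} -> {for X, continuous (fun Y => f Y + f' Y)}.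
  by move=> cf cf'; exact: cvgD.
have cC (a : R) : {for X, continuous (fun _ : 'cV[R]_6 * 'cV[R]_n => a)} by exact: cvg_cst.
exact: (cD _ _ (cD _ _ (cD _ _ (cD _ _ (cM _ _ (cM _ _ cp cp) (cC _))
  (cM _ _ (cM _ _ (cC _) (cM _ _ cq cq)) (cC _)))
  (cM _ _ (cM _ _ ce ce) (cC _))) (cM _ _ (cC _) (cM _ _ ce cp)))
  (cM _ _ (cC _) (cM _ _ cq cp))).
Qed.

Variables (A : 'M[R]_n) (B : 'M[R]_(n, 3)) (Gamma : 'M[R]_3).
Hypothesis CB : C *m B = Gamma.
Hypothesis CA : C *m A = - (Gamma *m phi%:M) *m C.

Let f := positive_feedback (rotational p g kp u1) (@attitude R) A B C.

Lemma angle_closed_loop (t : R) X i : angle (f t X).1 i = rate X.1 i.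
Proof. exact: rotational_angle. Qed.

(** Obtained by substituting [v = (e + eta) / phi]. *)
Lemma rate_closed_loop (t : R) X i : phi != 0 -> rate (f t X).1 i =
  input_gain p i * (error X i ord0 / phi - (kp i ord0 - 1 / phi) * angle X.1 i)
  + coupling p X.1 (g (quad_input kp (u1 t) X.1 (C *m X.2))) i.
Proof.
move=> phi0; rewrite [LHS]rotational_rate errorE mxE.
by congr (_ * _ + _); field.
Qed.

(** [CA] and [CB] turn the controller equation into [v' = - Gamma e], whatever the realization. *)
Lemma error_closed_loop (t : R) X i :
  error (f t X) i ord0 = - phi * (Gamma *m error X) i ord0 - rate X.1 i.
Proof.
have output : C *m (f t X).2 = - (Gamma *m error X).
  rewrite /f /positive_feedback /= mulmxDr !mulmxA CA CB mul_mx_scalar.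
  by rewrite /error mulmxBr opprB addrC -!scaleNr -!scalemxAl -scalemxAr !mulmxA scaleNr.
have oppE (u : 'cV[R]_3) : (- u) i ord0 = - u i ord0 by rewrite mxE.
rewrite {1}/error output mxE oppE attitudeE angle_closed_loop.
by congr (_ - _); rewrite mxE oppE mulrN mulNr.
Qed.

Lemma closed_loop_asymptotically_stable (D : 'M[R]_(n, 3)) :
  [/\ 0 < Jx p, 0 < Jy p & 0 < Jz p] -> 0 < arm p ->
  (forall r : R, [bounded g u | u in [set u : 'cV[R]_4 | `|u| <= r]]) ->
  [bounded u1 t | t in [set t : R | 0 <= t]] ->
  0 < phi -> (forall i, 1 / phi < kp i ord0) -> posdefmx Gamma ->
  D *m C = 1%:M -> asymptotically_stable f.
Proof.
move=> J0 l0 hg hu1 phi0 hkp hGamma DC.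
have phi_neq0 : phi != 0 by rewrite gt_eqF.
have [G G0 GP] := input_bounded hg hu1.
have [Fb Fb0 FbP] := coupling_bound p G0.
have [K K0 KP] := sqr_mulmx_le Gamma.
have [gam gam0 gamP] := posdefmx_coercive hGamma.
have [m [M [m0 M0 sizeP]]] := norm_state_size DC phi_neq0.
pose d i := input_gain p i; pose kappa i := kp i ord0 - 1 / phi.
have d0 i : 0 < d i.
  case: J0 => x0 y0 z0; rewrite /d /input_gain /b1 /b2 /b3.
  by case: i => [[|[|[|//]]] ?]; rewrite /= divr_gt0.
have k0 i : 0 < kappa i by rewrite subr_gt0.
have [lo [hi [lo0 hi0 loP hiP]]] : exists lo hi : R, [/\ 0 < lo, 0 < hi,
    forall i, lo <= d i <= hi & forall i, lo <= kappa i <= hi].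
  exists (Num.min (\big[Num.min/1]_i d i) (\big[Num.min/1]_i kappa i)).
  exists (1 + \sum_i d i + \sum_i kappa i).
  have Sd : 0 <= \sum_i d i by apply: sumr_ge0 => i _; exact: ltW.
  have Sk : 0 <= \sum_i kappa i by apply: sumr_ge0 => i _; exact: ltW.
  have term (h : 'I_3 -> R) (i : 'I_3) : (forall i, 0 < h i) -> h i <= \sum_i h i.
    by move=> h0; rewrite (bigD1 i)//= lerDl sumr_ge0// => j _; exact: ltW.
  split.
  - by rewrite lt_min; apply/andP; split; apply: lt_bigmin.
  - lra.
  - move=> i; rewrite ge_min bigmin_le//=.
    by have := term d i d0; lra.
  - move=> i; rewrite ge_min bigmin_le//= orbT /=.
    by have := term kappa i k0; lra.
(* Size of the cubic term in [coupling_power]. Dividing by [1 + chi] later keeps the radius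
   meaningful when [chi] is 0. *)
pose chi := `|(Jx p - Jy p) * (1 - 1 / arm p)|.
have chi0 : 0 <= chi by exact: normr_ge0.
have chi1 : 0 < 1 + chi by rewrite ltr_pwDl.
have [eps [h [sigma [c [[eps0 h0 sigma0 c0] [ehi elo ephi] strict]]]]] :=
  strict_lyapunov 3 phi0 lo0 hi0 gam0 K0 Fb0.
(* Radius 1 bounds the gyroscopic coefficients; the second radius makes the cubic term at most
   [sigma] times the squared rates. *)
have diss (t : R) X : 0 <= t -> `|X| < Num.min 1 (sigma / (1 + chi)) ->
  \sum_i axis_dissipation eps h phi (d i) (kappa i) (angle X.1 i) (rate X.1 i)
     (error X i ord0) ((Gamma *m error X) i ord0)
     (coupling p X.1 (g (quad_input kp (u1 t) X.1 (C *m X.2))) i)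
  <= - c * state_size X.
  move=> t0; rewrite lt_min => /andP[X1 Xs].
  have X1' : `|X.1| <= `|X| by rewrite norm_pairE le_max lexx.
  apply: strict => //.
  - by apply: FbP; [lra|exact/GP/ltW].
  - rewrite coupling_power//.
    have abs12 : `|rate X.1 (inord 0) * rate X.1 (inord 1)| <= \sum_i rate X.1 i ^+ 2.
      rewrite big_ord3 ler_norml.
      have := sqr_ge0 (rate X.1 (inord 0) + rate X.1 (inord 1)).
      have := sqr_ge0 (rate X.1 (inord 0) - rate X.1 (inord 1)).
      have := sqr_ge0 (rate X.1 (inord 0)); have := sqr_ge0 (rate X.1 (inord 1)).
      have := sqr_ge0 (rate X.1 (inord 2)); nra.
    have abs3 : `|rate X.1 (inord 2)| <= sigma / (1 + chi).
      by apply: le_trans (ltW Xs); apply: le_trans X1'; exact: coord_le_norm.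
    have s0 : 0 < sigma / (1 + chi) by rewrite divr_gt0.
    have sE : sigma / (1 + chi) * (1 + chi) = sigma by rewrite divfK// gt_eqF.
    have P0 : 0 <= \sum_i rate X.1 i ^+ 2 by apply: sumr_ge0 => i _; exact: sqr_ge0.
    apply: le_trans (ler_norm _) _; rewrite normrM -/chi normrM.
    apply: le_trans (_ : chi * ((\sum_i rate X.1 i ^+ 2) * (sigma / (1 + chi))) <= _).
      by rewrite ler_wpM2l// ler_pM.
    have key (a s P : R) : 0 <= P * s -> a * (P * s) <= s * (1 + a) * P by lra.
    by apply: le_trans (key _ _ _ (mulr_ge0 P0 (ltW s0))) _; rewrite sE.
pose N := hi + 1 / lo + 1 / phi + 2 * eps.
have N0 : 0 < N.
  have := divr_gt0 ltr01 lo0; have := divr_gt0 ltr01 phi0; rewrite /N; lra.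
pose W := closed_loop_lyapunov eps h.
have WP X : eps * state_size X <= W X /\ W X <= N * state_size X.
  have bounds i := axis_lyapunov_bounds (angle X.1 i) (rate X.1 i) (error X i ord0)
    phi0 lo0 (loP i) (hiP i) h0 eps0 ehi elo ephi.
  split; rewrite /W /closed_loop_lyapunov /state_size mulr_sumr;
    by apply: ler_sum => i _; have [] := bounds i.
have W_ge X : eps * m * `|X| ^+ 2 <= W X.
  by apply: le_trans (WP X).1; rewrite -mulrA ler_wpM2l ?(ltW eps0)//; exact: (sizeP X).1.
have W_le X : W X <= N * M * `|X| ^+ 2.
  by apply: le_trans (WP X).2 _; rewrite -mulrA ler_wpM2l ?(ltW N0)//; exact: (sizeP X).2.
pose r := Num.min 1 (sigma / (1 + chi)).
have r0 : 0 < r by rewrite lt_min ltr01 divr_gt0.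
have W_decay (x : R -> 'cV[R]_6 * 'cV[R]_n) (t : R) : 0 <= t ->
    is_derive t (1 : R) x (f t (x t)) -> `|x t| < r ->
    exists2 dW, is_derive t (1 : R) (W \o x) dW & dW <= - (c / N) * W (x t).
  move=> t0 dx xr; have := diss t (x t) t0 xr; set dW := \sum_i _ => dW_le.
  exists dW; last first.
    (* Decay at rate [c] in [state_size] becomes rate [c / N] in [W], as [W <= N * state_size]. *)
    apply: le_trans dW_le _; rewrite !mulNr lerN2 mulrAC ler_pdivrMr//.
    by rewrite -mulrA ler_wpM2l ?(ltW c0)// mulrC; exact: (WP _).2.
  have -> : W \o x = \sum_i (fun s => axis_lyapunov eps h phi (d i) (kappa i)
      (angle (x s).1 i) (rate (x s).1 i) (error (x s) i ord0)).
    by apply/funext => s; rewrite fct_sumE.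
  apply: is_derive_sum => i.
  have dq := is_derive_linear (@angle_continuous i) (@angle_linear i) dx.
  have dp := is_derive_linear (@rate_continuous i) (@rate_linear i) dx.
  have de := is_derive_linear (@error_continuous i) (@error_linear i) dx.
  rewrite angle_closed_loop in dq; rewrite rate_closed_loop// in dp.
  rewrite error_closed_loop in de.
  exact: (is_derive_axis_lyapunov eps h (lt0r_neq0 (d0 i)) phi_neq0 dq dp de).
have em0 : 0 < eps * m by rewrite mulr_gt0.
have NM0 : 0 < N * M by rewrite mulr_gt0.
have cN0 : 0 < c / N by rewrite divr_gt0.
have cW := @closed_loop_lyapunov_continuous eps h.
split.
(* Zero is written as a pair so that projections reduce. Each occurrence of [g] is multiplied by a
   rate, so its value is irrelevant at the origin. *)
- move=> t _; pose O : 'cV[R]_6 * 'cV[R]_n := (0, 0).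
  rewrite -[0 in LHS]/O -[0 in RHS]/O /f /positive_feedback /= !mulmx0.
  have z (k : nat) l : coord1 (0 : 'cV[R]_k.+1) l = 0 by rewrite /coord1 mxE.
  congr pair.
    apply/matrixP => i j; rewrite /rotational /vec6 !mxE !z.
    by rewrite !(mulr0, mul0r, subr0, addr0); case: i => [[|[|[|[|[|[|//]]]]]] ?].
  rewrite add0r (_ : attitude 0 = 0) ?mulmx0//.
  by apply/matrixP => i j; rewrite ord1 attitudeE /angle !mxE.
- exact: (lyapunov_stability em0 NM0 cN0 r0 cW W_ge W_le W_decay).
- exact: (lyapunov_attractivity em0 NM0 cN0 r0 cW W_ge W_le W_decay).
Qed.

End ControlledQuadrotor.

(** * From the tuning condition on [phi] to positive stiffness on each axis *)

Theorem theorem3 (R : realType) (p : quadrotor R)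
  (hJ : [/\ 0 < Jx p, 0 < Jy p & 0 < Jz p]) (harm : 0 < arm p)
  (* scalar function of the input, bounded on bounded sets *)
  (g : 'cV[R]_4 -> R)
  (hg : forall r : R, [bounded g u | u in [set u : 'cV[R]_4 | `|u| <= r]])
  (* thrust signal *)
  (u1 : R -> R)
  (hu1 : [bounded u1 t | t in [set t : R | 0 <= t]])
  (kphi ktheta kpsi : R)
  (hk : [/\ 0 < kphi, 0 < ktheta & 0 < kpsi])
  (Gamma Phi : 'M[R]_3) (phi : R)
  (hGamma : posdefmx Gamma) (hPhi : posdefmx Phi)
  (hPhiE : Phi = phi%:M)
  (hphi : phi ^+ 2 >
     Num.max (1 / kphi ^+ 2) (Num.max (1 / ktheta ^+ 2) (1 / kpsi ^+ 2)))
  (hSNI : strictly_negative_imaginary (Cv Gamma Phi))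
  (* state-space model of the controller *)
  (n : nat) (A : 'M[R]_n) (B : 'M[R]_(n, 3)) (C : 'M[R]_(3, n))
  (hABC : is_minimal_realization (Cv Gamma Phi) A B C)
  (hZSO : zero_state_observable
     (rotational p g (vec3 kphi ktheta kpsi) u1) (@attitude R)) :
  asymptotically_stable
    (positive_feedback (rotational p g (vec3 kphi ktheta kpsi) u1) (@attitude R)
       A B C).
Proof.
case: hJ => x0 y0 z0; case: hk => kphi0 ktheta0 kpsi0.
(* The sign comes from testing the form of [Phi] on the all-ones vector. *)
have phi0 : 0 < phi.
  have [gam gam0 /(_ (const_mx 1))] := posdefmx_coercive hPhi.
  by rewrite hPhiE mul_scalar_mx !big_ord3 !mxE; lra.
(* If [phi * k <= 1] then its square is at most 1, against the hypothesis. *)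
have invphi k : 0 < k -> 1 / k ^+ 2 < phi ^+ 2 -> 1 / phi < k.
  move=> k0; rewrite ltr_pdivrMr ?exprn_gt0// -exprMn => k1.
  rewrite ltr_pdivrMr// mulrC ltNge; apply/negP => le1.
  by move: k1; rewrite ltNge exprn_ile1// mulr_ge0// ltW.
move: hphi; rewrite !gt_max => /and3P[h1 h2 h3].
rewrite hPhiE in hABC.
have [[D DC] CB CA] := Cv_minimal_realization hGamma hABC.
apply: (closed_loop_asymptotically_stable CB CA) DC => // i.
by rewrite /vec3 mxE; case: i => [[|[|[|//]]] ?]; exact: invphi.
Qed.
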